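(* \[\sum_{n\ge0}p_n(1123,1211)t^n=\frac{(1-t^2)\sqrt{(1-t)(1-t-4t^2)}}{2t^2(1-3t+t^2)}-\frac{1-3t-2t^2+14t^3-15t^4+3t^5}{2t^2(1-t)^2(1-3t+t^2)}.\]
   Context: Set partitions of $[n]$ are written in canonical sequential form (restricted growth words $\pi_1\cdots\pi_n$ with $\pi_1=1$, $\pi_{i+1}\le\max(\pi_1,\dots,\pi_i)+1$). A partition contains a pattern if it has a subsequence order-isomorphic to it; $p_n(T)$ counts partitions of $[n]$ avoiding every pattern in $T$ (with $p_0=1$). The square root is the branch that is a power series with constant term $1$. *)

(* Defs.v *)
From HB Require Import structures.
From mathcomp Require Import all_boot all_order all_algebra.
Set Implicit Arguments. Unset Strict Implicit. Unset Printing Implicit Defensive.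
Import Order.TTheory GRing.Theory Num.Theory.

(* Restricted growth words with values starting at 1:
   pi_1 = 1 and pi_(i+1) <= max(pi_1..pi_i) + 1 (and all letters >= 1).
   [rgw_aux m s] checks s given that the current maximum is m. *)
Fixpoint rgw_aux (m : nat) (s : seq nat) : bool :=
  match s with
  | [::] => true
  | x :: s' => (0 < x <= m.+1) && rgw_aux (maxn m x) s'
  end.
Definition is_rgw (s : seq nat) : bool := rgw_aux 0 s.

Definition order_iso (u v : seq nat) : bool :=
  (size u == size v) &&
  [forall i : 'I_(size u), forall j : 'I_(size u),
     ((nth 0 u i < nth 0 u j) == (nth 0 v i < nth 0 v j)) &&
     ((nth 0 u i == nth 0 u j) == (nth 0 v i == nth 0 v j))].

Definition contains (w p : seq nat) : bool :=
  [exists m : (size w).-tuple bool, order_iso (mask m w) p].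

Definition avoids_all (T : seq (seq nat)) (w : seq nat) : bool :=
  all (fun p => ~~ contains w p) T.

(* p_n(T): number of set partitions of [n] (in canonical sequential form)
   avoiding every pattern of T.  Letters of such words of length n lie in
   {1..n}, so they are encoded as tuples over 'I_n.+1 (map val is injective). *)
Definition p_count (T : seq (seq nat)) (n : nat) : nat :=
  #|[pred t : n.-tuple 'I_n.+1 |
      is_rgw (map val t) && avoids_all T (map val t)]|.

Local Open Scope ring_scope.
Definition ser_mul (f g : nat -> rat) (n : nat) : rat :=
  \sum_(i < n.+1) f i * g (n - i)%N.
Definition poly_ser (p : {poly rat}) (n : nat) : rat := p`_n.
Definition ser_sub (f g : nat -> rat) (n : nat) : rat := f n - g n.

(* Main.v *)
(* For a nonempty avoider w let w+ be w with every letter raised by 1.  Every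
   avoider starting with 1 2 is either 1 w+ or is obtained from it by inserting
   one further 1, not directly after the first one, such that the letters behind
   it weakly decrease.  So the number of insertions depends only on the length e
   of the longest weakly decreasing suffix of w: the new suffix has length
   e (no insertion), e + 1 (insertion at the end) or any r in {1, .., e}, except
   that r = e is excluded when w is constant.  Weighting the avoider w by T_e,
   the solution of T_e = 1 + t T_e + t^2 (T_1 + .. + T_(e+1)), makes the sum over
   all avoiders telescope to a sum over the explicit avoiders that are constant or
   start with 1 1.
   Here T_e = C^e D with C = 1 + t^2 C D and D = C / (1 - t), so that
   2 t^2 C = 1 - t - S.  Power series are handled modulo t^N. *)
Require Import Defs.
From HB Require Import structures.
From mathcomp Require Import all_boot all_order all_algebra.
From mathcomp Require Import qpoly zify ring lra.
Import Order.TTheory GRing.Theory Num.Theory.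

(** * Avoidance in terms of subsequences *)

Definition pats : seq (seq nat) := [:: [:: 1; 1; 2; 3]; [:: 1; 2; 1; 1]].
Definition good (w : seq nat) : bool := is_rgw w && avoids_all pats w.

Lemma containsP w p : reflect (exists2 s, subseq s w & order_iso s p) (contains w p).
Proof.
apply: (iffP existsP) => [[m iso] | [s /subseqP[m szm ->] iso]].
  by exists (mask m w); rewrite ?mask_subseq.
by exists (tcast szm (in_tuple m)); rewrite val_tcast.
Qed.

Lemma order_isoP (u v : seq nat) :
  reflect (size u = size v /\ forall i j, i < size u -> j < size u ->
             (nth 0 u i < nth 0 u j) = (nth 0 v i < nth 0 v j) /\
             (nth 0 u i == nth 0 u j) = (nth 0 v i == nth 0 v j))
          (order_iso u v).
Proof.
apply: (iffP andP) => [[/eqP -> /forallP iso] | [/eqP szE iso]]; split=> //.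
  move=> i j lti ltj; have /forallP/(_ (Ordinal ltj)) := iso (Ordinal lti).
  by case/andP=> /eqP -> /eqP ->.
apply/forallP=> i; apply/forallP=> j; have [-> ->] := iso i j (ltn_ord i) (ltn_ord j);
by rewrite !eqxx.
Qed.

Lemma order_iso1123 s : order_iso s [:: 1; 1; 2; 3] <->
  exists a b c, [/\ s = [:: a; a; b; c], a < b & b < c].
Proof.
split=> [/order_isoP[] | [a [b [c [-> ltab ltbc]]]]].
  case: s => [|a [|a' [|b [|c [|]]]]] //= _ iso.
  have /eqP <- : a == a' by have [_ ->] := iso 0 1 isT isT.
  exists a, b, c; split=> //; first by have [->] := iso 0 2 isT isT.
  by have [->] := iso 2 3 isT isT.
apply/order_isoP; split=> // i j.
by case: i => [|[|[|[|]]]] //; case: j => [|[|[|[|]]]] //= _ _; lia.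
Qed.

Lemma order_iso1211 s : order_iso s [:: 1; 2; 1; 1] <->
  exists a b, s = [:: a; b; a; a] /\ a < b.
Proof.
split=> [/order_isoP[] | [a [b [-> ltab]]]].
  case: s => [|a [|b [|a' [|a'' [|]]]]] //= _ iso.
  have /eqP <- : a == a' by have [_ ->] := iso 0 2 isT isT.
  have /eqP <- : a == a'' by have [_ ->] := iso 0 3 isT isT.
  by exists a, b; split=> //; have [->] := iso 0 1 isT isT.
apply/order_isoP; split=> // i j.
by case: i => [|[|[|[|]]]] //; case: j => [|[|[|[|]]]] //= _ _; lia.
Qed.

Lemma goodP w : good w <->
  [/\ is_rgw w, forall a b c, a < b -> b < c -> ~~ subseq [:: a; a; b; c] w
    & forall a b, a < b -> ~~ subseq [:: a; b; a; a] w].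
Proof.
rewrite /good /avoids_all /=; split.
  case/and4P=> rgw av1 av2 _; split=> // [a b c ltab ltbc | a b ltab].
    apply: contra av1 => sub; apply/containsP; exists [:: a; a; b; c] => //.
    by apply/order_iso1123; exists a, b, c.
  apply: contra av2 => sub; apply/containsP; exists [:: a; b; a; a] => //.
  by apply/order_iso1211; exists a, b.
case=> -> av1 av2; rewrite andbT /=; apply/andP; split.
  apply/negP=> /containsP[s sub /order_iso1123[a [b [c [sE ltab ltbc]]]]].
  by move: (av1 a b c ltab ltbc); rewrite -sE sub.
apply/negP=> /containsP[s sub /order_iso1211[a [b [sE ltab]]]].
by move: (av2 a b ltab); rewrite -sE sub.
Qed.

(** For a growth word this is the canonical word of the partition left after its first block is
    deleted. *)
Definition drop_ones (s : seq nat) : seq nat := [seq x.-1 | x <- s & 1 < x].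

Lemma subseq_mapP (T1 T2 : eqType) (f : T1 -> T2) s w :
  reflect (exists2 s', subseq s' w & s = map f s') (subseq s (map f w)).
Proof.
apply: (iffP idP) => [/subseqP[m szm ->] | [s' sub ->]]; last exact: map_subseq.
by exists (mask m w); rewrite ?mask_subseq // map_mask.
Qed.

Lemma map_succ_par s : map succn (drop_ones s) = [seq x <- s | 1 < x].
Proof. by elim: s => //= -[|[|x]] s IHs //=; rewrite -/(drop_ones s) IHs. Qed.

Lemma par_map_succ s : all (leq 1) s -> drop_ones (map succn s) = s.
Proof.
by elim: s => //= -[|x] s IHs //= pos_s; rewrite /drop_ones /=
  -/(drop_ones (map succn s)) IHs.
Qed.

Lemma rgw_aux_par m s : rgw_aux m.+1 s = all (leq 1) s && rgw_aux m (drop_ones s).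
Proof.
elim: s m => //= -[|[|x]] s IHs m //=.
  by rewrite maxnSS maxn0 IHs.
by rewrite -/(drop_ones s) maxnSS IHs [LHS]andbCA.
Qed.

Lemma subseq_par s w : all (leq 1) s -> subseq s (drop_ones w) = subseq (map succn s) w.
Proof.
move=> pos_s; have -> : subseq (map succn s) w = subseq (map succn s) (map succn (drop_ones w)).
  rewrite map_succ_par subseq_filter; suff -> : all (fun x => 1 < x) (map succn s) by [].
  by rewrite all_map; apply: sub_all pos_s.
apply/idP/idP=> [|/subseq_mapP[s' sub /inj_map]]; first exact: map_subseq.
by move=> -> //; apply: succn_inj.
Qed.

(** In both patterns the repeated letter [a] is the smallest one. If [a] exceeds 1, the occurrence
    survives in [drop_ones s]. If [a] is 1, its first letter may be taken to be the leading 1, and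
    the remaining three letters lie in [s]. *)
Lemma good_cons1 s : good (1 :: s) <->
  [/\ all (leq 1) s, good (drop_ones s),
      forall b c, 1 < b -> b < c -> ~~ subseq [:: 1; b; c] s
    & forall b, 1 < b -> ~~ subseq [:: b; 1; 1] s].
Proof.
split.
  case/goodP; rewrite /is_rgw /= max0n rgw_aux_par => /andP[pos_s rgw] av1 av2.
  split=> //.
  - apply/goodP; split=> // [[|a] b c ltab ltbc | [|a] b ltab].
    + by apply/negP=> /mem_subseq/(_ 0 (mem_head _ _))/mapP[[|[|x]]]; rewrite mem_filter.
    + rewrite subseq_par /=; last by lia.
      by have := av1 a.+2 b.+1 c.+1 ltab ltbc.
    + by apply/negP=> /mem_subseq/(_ 0 (mem_head _ _))/mapP[[|[|x]]]; rewrite mem_filter.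
    + rewrite subseq_par /=; last by lia.
      by have := av2 a.+2 b.+1 ltab.
  - by move=> b c lt1b ltbc; have := av1 1 b c lt1b ltbc.
  - by move=> b lt1b; have := av2 1 b lt1b.
case=> pos_s /goodP[rgw av1 av2] av3 av4; apply/goodP; split.
    by rewrite /is_rgw /= max0n rgw_aux_par pos_s.
  move=> [|[|a]] b c ltab ltbc /=.
  - by apply/negP=> /mem_subseq/(_ 0 (mem_head _ _)) /(allP pos_s).
  - exact: av3.
  - case: b ltab ltbc => [|b] //; case: c => [|c] // ltab ltbc.
    by have := av1 a.+1 b c ltab ltbc; rewrite subseq_par //=; lia.
move=> [|[|a]] b ltab /=.
- by apply/negP=> /mem_subseq/(_ 0 (mem_head _ _)) /(allP pos_s).
- exact: av4.
- case: b ltab => [|b] // ltab.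
  by have := av2 a.+1 b ltab; rewrite subseq_par //=; lia.
Qed.

(** * Prepending and inserting a smallest letter *)

Lemma sorted_geqP s :
  (forall b c, b < c -> ~~ subseq [:: b; c] s) <-> sorted geq s.
Proof.
rewrite sorted_pairwise; last by move=> y x z /=; lia.
elim: s => //= x s IHs; split.
  move=> dec; apply/andP; split.
    apply/allP=> y s_y /=; rewrite leqNgt; apply/negP=> ltxy.
    by have := dec x y ltxy; rewrite eqxx sub1seq s_y.
  apply/IHs => b c ltbc; apply: contra (dec b c ltbc) => sub.
  exact: (subseq_trans sub (subseq_cons s x)).
case/andP=> /allP x_max /IHs dec b c ltbc; case: eqP => [bx|_]; last exact: dec.
rewrite sub1seq; apply/negP=> /x_max /=; lia.
Qed.

Lemma sorted_geq_map_succ s : sorted geq (map succn s) = sorted geq s.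
Proof. by rewrite sorted_map. Qed.

Lemma good_pos w : good w -> all (leq 1) w.
Proof.
case: w => // x s /[dup] /goodP[/andP[lex _] _ _].
have -> : x = 1 by lia.
by case/good_cons1=> /= ->.
Qed.

Lemma good_head w : good w -> w = [::] \/ exists s, w = 1 :: s.
Proof.
case: w => [|x s /goodP[/andP[lex _] _ _]]; [by left | right; exists s].
congr (_ :: _); lia.
Qed.

Lemma one_notin_map_succ s : all (leq 1) s -> 1 \notin map succn s.
Proof. by move=> /allP pos_s; apply/negP=> /mapP[[|x] /pos_s]. Qed.

(** Both subsequence conditions of [good_cons1] concern subsequences with a 1, and [map succn w] has
    no 1. *)
Lemma good_elevate w : all (leq 1) w -> good (1 :: map succn w) = good w.
Proof.
move=> pos_w; have n1 := one_notin_map_succ _ pos_w.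
apply/idP/idP => [/good_cons1[_]|good_w]; first by rewrite par_map_succ.
apply/good_cons1; split; rewrite ?par_map_succ //.
- by rewrite all_map; apply/allP=> x _.
- by move=> b c _ _; apply: contra n1 => /mem_subseq sub; apply: sub; rewrite mem_head.
- by move=> b _; apply: contra n1 => /mem_subseq sub; apply: sub; rewrite !inE eqxx !orbT.
Qed.

Lemma subseq_cons_notin (T : eqType) (x : T) q u v :
  x \notin u -> subseq (x :: q) (u ++ x :: v) = subseq q v.
Proof.
elim: u => [|y u IHu] /=; first by rewrite eqxx.
by rewrite inE negb_or => /andP[/negPf ->] /IHu.
Qed.

Lemma par_insert u v : all (leq 1) (u ++ v) ->
  drop_ones (map succn u ++ 1 :: map succn v) = u ++ v.
Proof.
rewrite all_cat => /andP[pos_u pos_v].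
by rewrite /drop_ones filter_cat map_cat /= -/(drop_ones _) -/(drop_ones _) !par_map_succ.
Qed.

(** The tail contains exactly one 1. So [b 1 1] cannot occur, and [1 b c] has to start at that 1,
    which leaves the condition that no pair [b < c] occurs in this order behind it. *)
Lemma good_insert u v : all (leq 1) (u ++ v) ->
  good (1 :: map succn u ++ 1 :: map succn v) = good (u ++ v) && sorted geq v.
Proof.
move=> pos_uv; have /andP[pos_u pos_v] : all (leq 1) u && all (leq 1) v by rewrite -all_cat.
have n1u := one_notin_map_succ _ pos_u; have n1v := one_notin_map_succ _ pos_v.
apply/idP/andP => [/good_cons1[_] | [good_uv dec_v]].
  rewrite par_insert // => -> asc _; split=> //.
  rewrite -sorted_geq_map_succ; apply/sorted_geqP=> b c ltbc.
  have [lt1b | leb1] := ltnP 1 b.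
    by have := asc b c lt1b ltbc; rewrite subseq_cons_notin.
  apply/negP=> /mem_subseq/(_ b (mem_head _ _))/mapP[x vx bE].
  by have /= := allP pos_v x vx; lia.
apply/good_cons1; split; rewrite ?par_insert //.
- by rewrite all_cat /= !all_map; apply/andP; split; apply/allP=> x _.
- move=> b c _ ltbc; rewrite subseq_cons_notin //.
  by move: b c ltbc; apply/sorted_geqP; rewrite sorted_geq_map_succ.
- move=> b _; apply/negP=> /(leq_count_subseq (pred1 1)).
  rewrite count_cat /= (count_memPn n1u) (count_memPn n1v); lia.
Qed.

(** Here [r] counts the letters behind the inserted 1, so that admissibility becomes an upper bound
    on [r]. *)
Definition insert_one (w : seq nat) (r : nat) : seq nat :=
  1 :: map succn (take (size w - r) w) ++ 1 :: map succn (drop (size w - r) w).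

(** * Length of the longest weakly decreasing suffix *)

Fixpoint wdsuffix (s : seq nat) : nat :=
  if s is x :: s' then if sorted geq s then size s else wdsuffix s' else 0.

Lemma wdsuffix_sorted s : sorted geq s -> wdsuffix s = size s.
Proof. by case: s => //= x s ->. Qed.

Lemma wdsuffix_cons x s : ~~ sorted geq (x :: s) -> wdsuffix (x :: s) = wdsuffix s.
Proof. by move=> /= /negPf ->. Qed.

Lemma wdsuffix_size s : wdsuffix s <= size s.
Proof. by elim: s => //= x s IHs; case: ifP => // _; apply: leqW. Qed.

Lemma wdsuffix_eq_size s : (wdsuffix s == size s) = sorted geq s.
Proof.
case: s => //= x s; case: ifP => [|_]; first by rewrite eqxx.
by apply/negP=> /eqP E; have := wdsuffix_size s; rewrite E ltnn.
Qed.

Lemma sorted_suffix u v : sorted geq (u ++ v) -> sorted geq v.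
Proof. by move/cat_sorted2 => []. Qed.

(** Suffixes of a weakly decreasing word are weakly decreasing, so the lengths of such suffixes form
    an initial segment. *)
Lemma leq_wdsuffix s r : r <= size s -> (r <= wdsuffix s) = sorted geq (drop (size s - r) s).
Proof.
elim: s r => [|x s IHs] r /=; first by rewrite leqn0 => /eqP->.
rewrite leq_eqVlt => /predU1P[-> | ltr].
  rewrite subnn /=; case: ifP => [_|_]; first exact: leqnn.
  by apply/negbTE; rewrite -ltnNge ltnS wdsuffix_size.
rewrite subSn //=; case: ifP => [dec | _]; last exact: IHs.
rewrite ltnW //; apply/esym; apply: (@sorted_suffix (take (size s - r) s)).
by rewrite cat_take_drop; apply: path_sorted dec.
Qed.

Lemma wdsuffix_map_succ s : wdsuffix (map succn s) = wdsuffix s.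
Proof.
elim: s => // x s IHs; rewrite [LHS]/= size_map IHs.
by rewrite -[path _ _ _]/(sorted geq (map succn (x :: s))) sorted_geq_map_succ.
Qed.

(** The leading 1 is followed by a letter above 1, so it cannot join a weakly decreasing suffix.
    This fails for the empty word. *)
Lemma wdsuffix_elevate x s : all (leq 1) (x :: s) ->
  wdsuffix (1 :: map succn (x :: s)) = wdsuffix (x :: s).
Proof.
case/andP=> x_gt0 _; rewrite wdsuffix_cons ?wdsuffix_map_succ //=.
by rewrite negb_and -ltnNge ltnS x_gt0.
Qed.

Lemma wdsuffix_cat_asc u y x v : y < x -> sorted geq (x :: v) ->
  wdsuffix (u ++ y :: x :: v) = (size v).+1.
Proof.
move=> ltyx dec_v; elim: u => [|z u IHu].
  by rewrite wdsuffix_cons ?wdsuffix_sorted //= negb_and -ltnNge ltyx.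
rewrite cat_cons wdsuffix_cons //=; apply/negP=> /path_sorted /sorted_suffix /=.
by rewrite leqNgt ltyx.
Qed.

Lemma wdsuffix_rcons1 u : all (leq 1) u -> wdsuffix (rcons u 1) = (wdsuffix u).+1.
Proof.
elim: u => //= x u IHu /andP[x_gt0 pos_u]; rewrite rcons_path size_rcons.
have /allP/(_ _ (mem_last x u)) last_pos : all (leq 1) (x :: u) by rewrite /= x_gt0.
rewrite /= last_pos andbT; case: ifP => // _; exact: IHu.
Qed.

(** * Decomposition of the set of avoiders *)

Lemma good_ones n : good (nseq n 1).
Proof.
apply/goodP; split.
- by rewrite /is_rgw; case: n => //= n; rewrite max0n; elim: n.
- move=> a b c ltab ltbc; apply/negP=> /mem_subseq sub.
  have := sub a; have := sub b; rewrite !inE !eqxx !orbT !mem_nseq; lia.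
- move=> a b ltab; apply/negP=> /mem_subseq sub.
  have := sub a; have := sub b; rewrite !inE !eqxx !orbT !mem_nseq; lia.
Qed.

(** A nonempty growth word starts with 1, which then bounds all its positive letters from above. *)
Lemma good_sorted w : good w -> sorted geq w -> w = nseq (size w) 1.
Proof.
move=> good_w; have pos_w := good_pos _ good_w.
case: (good_head _ good_w) pos_w => [-> // | [s ->]] /= /allP pos_s.
rewrite path_sortedE; last by move=> y x z /=; lia.
case/andP=> /allP max1 _; congr (_ :: _); apply/all_pred1P/allP => x sx.
have := max1 x sx; have := pos_s x sx; rewrite /=; lia.
Qed.

(** * Avoiders that start with 1 1 *)

Definition low12 (s : seq nat) : bool :=
  all (mem [:: 1; 2]) s && ~~ subseq [:: 2; 1; 1] s.

Lemma par_cons1 s : drop_ones (1 :: s) = drop_ones s. Proof. by []. Qed.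

Lemma par_low s : all (mem [:: 1; 2]) s -> exists n, drop_ones s = nseq n 1.
Proof.
elim: s => [|x s IHs] /=; first by exists 0.
rewrite !inE => /andP[/orP[]/eqP-> /IHs[n E]]; first by exists n.
by exists n.+1; rewrite /drop_ones /= -/(drop_ones s) E.
Qed.

(** After 1 1 any ascending pair of letters above 1 completes 1123. So [drop_ones s] is weakly
    decreasing, hence constant 1 by [good_sorted], and [s] uses only 1 and 2. Then 1211 can only
    arise from the leading 1 and a subsequence 2 1 1. *)
Lemma good_11 s : good (1 :: 1 :: s) = low12 s.
Proof.
apply/idP/andP => [/good_cons1[] | [low_s no211]].
  rewrite par_cons1 => /= pos_s good_par asc rep; split; last exact: (rep 2 isT).
  have dec : sorted geq (drop_ones s).
    apply/sorted_geqP=> b c ltbc; case: b ltbc => [|b] ltbc.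
      by apply/negP=> /mem_subseq/(_ 0 (mem_head _ _))/mapP[[|[|x]]]; rewrite mem_filter.
    by rewrite subseq_par /=; [exact: asc | lia].
  apply/allP=> x sx; rewrite !inE.
  have [le1 | lt1] := leqP x 1; first by have := allP pos_s x sx; lia.
  have : x.-1 \in drop_ones s by apply/mapP; exists x; rewrite ?mem_filter ?lt1.
  by rewrite (good_sorted _ good_par dec) mem_nseq; lia.
have [n parE] := par_low _ low_s.
apply/good_cons1; split; rewrite ?par_cons1 ?parE ?good_ones //=.
- by apply/allP=> x /(allP low_s); rewrite !inE => /orP[]/eqP->.
- move=> b c lt1b ltbc; apply/negP=> /mem_subseq/(_ c).
  rewrite !inE eqxx orbT => /(_ isT) /(allP low_s); rewrite !inE; lia.
- move=> b lt1b; case: eqP => [|_]; first by lia.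
  apply/negP=> sub; have : b \in s by apply: (mem_subseq sub); rewrite mem_head.
  move/(allP low_s); rewrite !inE => b12.
  by have b2 : b = 2 by [lia]; rewrite b2 (negPf no211) in sub.
Qed.

(** After the prefix 1 1 2 come [k] letters from 1 and 2. Two further 1s would give 1211, so there
    is at most one, and [m] counts the letters behind it. *)
Definition start112 (k : nat) : seq (seq nat) :=
  [:: 1, 1, 2 & nseq k 2] ::
  [seq [:: 1, 1, 2 & nseq (k.-1 - m) 2 ++ 1 :: nseq m 2] | m <- iota 0 k].

(** If the third letter is 1, removing the leading 1 leaves a shorter word of the same kind;
    otherwise the word starts with 1 1 2. Constant words are left out. *)
Fixpoint start11 (n : nat) : seq (seq nat) :=
  if n is n'.+1 then
    map (cons 1) (start11 n') ++ (if n' is k.+2 then start112 k else [::])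
  else [::].

Lemma all_nseq2 n : all (mem [:: 1; 2]) (nseq n 2).
Proof. by rewrite all_nseq orbT. Qed.

Lemma not_subseq11 n m : ~~ subseq [:: 1; 1] (nseq n 2 ++ 1 :: nseq m 2).
Proof.
apply/negP=> /(leq_count_subseq (pred1 1)).
by rewrite count_cat /= !count_nseq.
Qed.

Lemma mem_start112 k w : w \in start112 k <->
  exists s, [/\ w = [:: 1, 1, 2 & s], size s = k & low12 (2 :: s)].
Proof.
split.
  rewrite inE => /predU1P[-> | /mapP[m]].
    exists (nseq k 2); rewrite size_nseq; split=> //.
    rewrite /low12 /= all_nseq2 /=; apply/negP=> /(leq_count_subseq (pred1 1)).
    by rewrite /= count_nseq.
  rewrite mem_iota => ltm ->; exists (nseq (k.-1 - m) 2 ++ 1 :: nseq m 2); split=> //.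
    by rewrite size_cat /= !size_nseq; lia.
  by rewrite /low12 /= all_cat /= !all_nseq2 not_subseq11.
case=> s [-> <-] /andP[/= low_s no11]; rewrite inE.
have eq_nseq2 (s' : seq nat) : all (mem [:: 1; 2]) s' -> 1 \notin s' -> s' = nseq (size s') 2.
  move=> /allP low_s' no1; apply/all_pred1P/allP=> x sx.
  have := low_s' x sx; rewrite !inE => /orP[/eqP x1|//].
  by rewrite -x1 sx in no1.
have [s1 | no1] := boolP (1 \in s); last by rewrite {1}(eq_nseq2 s low_s no1) eqxx.
(* The word is split at a 1; as 1 1 is not a subsequence, neither side has another 1. *)
apply/orP; right; case/splitPr: s1 low_s no11 => p1 p2.
rewrite all_cat /= => /andP[low1 low2] no11.
have no1p1 : 1 \notin p1.
  apply: contra no11 => p1_1; apply: (cat_subseq (s1 := [:: 1]) (s2 := [:: 1])).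
    by rewrite sub1seq.
  by rewrite /= sub0seq.
have no1p2 : 1 \notin p2.
  apply: contra no11 => p2_1; apply: (cat_subseq (s1 := [::]) (s2 := [:: 1; 1])).
    exact: sub0seq.
  by rewrite /= sub1seq.
apply/mapP; exists (size p2); first by rewrite mem_iota size_cat /=; lia.
rewrite -(eq_nseq2 p2 low2 no1p2) size_cat /= addnS /= addnK.
by rewrite -(eq_nseq2 p1 low1 no1p1).
Qed.

Lemma mem_start11 n w : w \in start11 n <->
  exists s, [/\ w = 1 :: 1 :: s, (size s).+2 = n, low12 s & 2 \in s].
Proof.
elim: n w => [|n IHn] w /=; first by split=> // [[s []]].
rewrite mem_cat; split.
  case/orP=> [/mapP[w' /IHn[s [-> <- low_s s2] ->]] | ].
    by exists (1 :: s).
  case: n IHn => [|[|k]] _ // /mem_start112[s [-> <- low_s]].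
  by exists (2 :: s); rewrite mem_head.
case=> [[|x s]] [-> //= [nE] low_s s2].
have : x \in [:: 1; 2] by case/andP: low_s => /andP[].
rewrite !inE => /orP[]/eqP x_eq; rewrite {}x_eq in low_s s2 *.
  rewrite map_f //; apply/IHn; by exists s; split.
apply/orP; right; rewrite -nE; apply/mem_start112.
by exists s.
Qed.

Lemma uniq_start112 k : uniq (start112 k).
Proof.
rewrite /start112 cons_uniq; apply/andP; split.
  apply/mapP=> [[m _ [E]]].
  have : 1 \in nseq k 2 by rewrite E mem_cat mem_head orbT.
  by rewrite mem_nseq andbF.
rewrite map_inj_in_uniq ?iota_uniq // => m m'; rewrite !mem_iota => ltm ltm' [E].
have := congr1 (index 1) E; rewrite !index_cat !mem_nseq !andbF /= !size_nseq; lia.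
Qed.

Lemma uniq_start11 n : uniq (start11 n).
Proof.
elim: n => //= n IHn; rewrite cat_uniq map_inj_uniq ?IHn => [|s s' [] //].
rewrite /=; apply/andP; split; last by case: (n) => [|[|k]] //; apply: uniq_start112.
apply/hasPn=> w; case: (n) => [|[|k]] // /mem_start112[s [-> _ _]].
by apply/negP=> /mapP[w' /mem_start11[s' [-> _ _ _]]].
Qed.

(** * The list of all avoiders of a given length and its decomposition *)

Definition words (n : nat) : seq (seq nat) :=
  [seq map val (t : n.-tuple 'I_n.+1) |
     t <- enum [pred t : n.-tuple 'I_n.+1 | good (map val t)]].

Lemma uniq_words n : uniq (words n).
Proof.
rewrite map_inj_uniq ?enum_uniq // => t t' /inj_map E.
by apply/val_inj/E/val_inj.
Qed.

Lemma size_words n : size (words n) = p_count pats n.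
Proof. by rewrite size_map -cardE. Qed.

Lemma rgw_aux_bound m s : rgw_aux m s -> all (fun x => x <= m + size s) s.
Proof.
elim: s m => //= x s IHs m /andP[/andP[_ lex] /IHs bound].
apply/andP; split; first by lia.
by apply: sub_all bound => y /=; lia.
Qed.

Lemma mem_words n w : w \in words n <-> size w = n /\ good w.
Proof.
split; first by case/mapP=> t; rewrite mem_enum inE => good_t ->; rewrite size_map size_tuple.
case=> sz_w good_w; have /eqP sz : size (map (@inord n) w) = n by rewrite size_map.
have wE : map val (Tuple sz) = w.
  rewrite /= -map_comp -[RHS]map_id; apply/eq_in_map=> x wx /=.
  rewrite inordK // ltnS -sz_w; have /goodP[rgw _ _] := good_w.
  by have /allP/(_ x wx) := rgw_aux_bound _ _ rgw.
by apply/mapP; exists (Tuple sz); rewrite ?mem_enum ?inE wE.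
Qed.

(** This and the next lemma recover [w] and the position of the inserted 1 from the result, which
    makes insertion injective. *)
Lemma par_insert_one w r : all (leq 1) w -> drop_ones (behead (insert_one w r)) = w.
Proof.
by move=> pos_w; rewrite /= par_insert cat_take_drop.
Qed.

Lemma index_insert_one w r : all (leq 1) w -> index 1 (behead (insert_one w r)) = size w - r.
Proof.
move=> pos_w; rewrite /= index_cat.
rewrite (negPf (one_notin_map_succ _ _)) /=; last first.
  by apply/allP=> x /mem_take /(allP pos_w).
by rewrite addn0 size_map size_takel // leq_subr.
Qed.

Definition elevated n : seq (seq nat) := [seq 1 :: map succn w | w <- words n].
(** The bound [n] excludes [r = n], an insertion directly after the leading 1. It takes effect only
    if all of [w] is weakly decreasing, that is, if [w] is constant. *)
Definition inserted n : seq (seq nat) :=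
  [seq insert_one w r | w <- words n, r <- iota 0 (minn (wdsuffix w).+1 n)].

Lemma mem_elevated n w : w \in elevated n <->
  exists v, [/\ w = 1 :: map succn v, size v = n & good v].
Proof.
split=> [/mapP[v /mem_words[szv good_v] ->] | [v [-> szv good_v]]]; first by exists v.
by apply/mapP; exists v => //; apply/mem_words.
Qed.

Lemma mem_inserted n w : w \in inserted n <->
  exists u v, [/\ w = 1 :: map succn u ++ 1 :: map succn v, size (u ++ v) = n, u != [::],
                  sorted geq v & good (u ++ v)].
Proof.
split.
  case/allpairsPdep=> x [r [/mem_words[szx good_x]]].
  rewrite mem_iota add0n leq_min /= ltnS => /andP[ler ltr] ->.
  exists (take (size x - r) x), (drop (size x - r) x); rewrite cat_take_drop; split=> //.
    by rewrite -size_eq0 size_takel ?leq_subr // szx; lia.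
  by rewrite -leq_wdsuffix // szx ltnW.
case=> u [v [-> sz_uv u_nil dec_v good_uv]]; apply/allpairsPdep.
have szuE : size (u ++ v) - size v = size u by rewrite size_cat addnK.
exists (u ++ v), (size v); split; first exact/mem_words.
  rewrite mem_iota add0n leq_min ltnS leq_wdsuffix ?szuE ?drop_size_cat ?dec_v //=.
    by rewrite -sz_uv size_cat -[X in X < _]add0n ltn_add2r lt0n size_eq0.
  by rewrite size_cat leq_addl.
by rewrite /insert_one szuE take_size_cat // drop_size_cat.
Qed.

Lemma uniq_elevated n : uniq (elevated n).
Proof. by rewrite map_inj_uniq ?uniq_words // => w w' [] /(inj_map succn_inj). Qed.

Lemma uniq_inserted n : uniq (inserted n).
Proof.
apply: allpairs_uniq_dep => [|w _|]; [exact: uniq_words | exact: iota_uniq |].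
move=> x y /allpairsPdep[w [r [/mem_words[szw gw] r_lt ->]]].
case/allpairsPdep=> w' [r' [/mem_words[szw' gw'] r'_lt ->]] /= E.
have pw := good_pos _ gw; have pw' := good_pos _ gw'.
have ww' : w = w' by rewrite -(par_insert_one w r pw) E par_insert_one.
subst w'.
have := congr1 (fun s => index 1 (behead s)) E; rewrite /= -/(behead (insert_one w r)).
rewrite -/(behead (insert_one w r')) !index_insert_one // szw.
move: r_lt r'_lt; rewrite !mem_iota => r_lt r'_lt rr.
by have -> : r = r' by lia.
Qed.

(** The second letter is 1 or 2. If it is 1, the word is constant or lies in [start11]. If it is 2,
    there is either no further 1 (elevated) or exactly one (inserted). *)
Lemma words_decomposition n :
  perm_eq (words n.+2)
    (nseq n.+2 1 :: start11 n.+2 ++ elevated n.+1 ++ inserted n).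
Proof.
move: (start11 n.+2) (uniq_start11 n.+2) (mem_start11 n.+2) => e uniq_e mem_e.
apply: uniq_perm; first exact: uniq_words.
  rewrite cons_uniq !cat_uniq uniq_e uniq_elevated uniq_inserted /= andbT.
  (* The second letter, at index 1, separates the last two classes from the first two. *)
  have not11 w : w \in elevated n.+1 ++ inserted n -> nth 0 w 1 != 1.
    rewrite mem_cat => /orP[/mem_elevated[v [-> szv gv]] | /mem_inserted[u [v [-> _]]]].
      by case: v szv gv => // x v _ /good_pos /andP[x_gt0 _] /=; lia.
    by case: u => // x u _ _ /good_pos /andP[x_gt0 _] /=; lia.
  rewrite !mem_cat negb_or; apply/and3P; split.
  - apply/andP; split; last first.
      by rewrite -mem_cat; apply/negP=> /not11.
    apply/negP=> /mem_e[s [[sE] _ _ s2]]; rewrite -sE in s2.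
    by move: s2; rewrite mem_nseq andbF.
  - by apply/hasPn=> w /not11; apply: contra => /mem_e[s [->]].
  - apply/hasPn=> w /mem_inserted[u [v [-> _ _ _ _]]].
    (* An elevated word has no 1 besides the leading one. *)
    apply/negP=> /mem_elevated[x [[E] _ gx]].
    have := one_notin_map_succ _ (good_pos _ gx).
    by rewrite -E mem_cat mem_head orbT.
move=> w; apply/idP/idP.
  case/mem_words=> szw good_w; rewrite inE !mem_cat.
  case: (good_head _ good_w) szw => [-> // | [[|y s] wE]]; rewrite {}wE //= in good_w * => -[szs].
  have /goodP[/and3P[_ ley _] _ _] := good_w; rewrite max0n in ley.
  have [y1 | y2] : y = 1 \/ y = 2 by lia.
    rewrite {}y1 {ley} in good_w *; have low_s := good_w; rewrite good_11 in low_s.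
    have [s2 | no2] := boolP (2 \in s).
      suff -> : [:: 1, 1 & s] \in e by rewrite orbT.
      by apply/mem_e; exists s; rewrite szs.
    suff <- : s = nseq n 1 by rewrite eqxx.
    rewrite -szs; apply/all_pred1P/allP=> x sx; case/andP: low_s => /allP/(_ x sx).
    by rewrite !inE => /orP[// | /eqP x2]; rewrite -x2 sx in no2.
  rewrite {}y2 {ley} in good_w *.
  have succ_par (t : seq nat) : all (leq 1) t -> 1 \notin t -> map succn (drop_ones t) = t.
    move=> /allP pos_t no1; rewrite map_succ_par; apply/all_filterP/allP=> x tx.
    rewrite ltn_neqAle pos_t // andbT; apply: contra no1 => /eqP->; exact: tx.
  have /good_cons1[pos_s _ _ rep] := good_w.
  have [s1 | no1] := boolP (1 \in s); last first.
    suff -> : [:: 1, 2 & s] \in elevated n.+1 by rewrite !orbT.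
    have sE : map succn (drop_ones (2 :: s)) = 2 :: s by rewrite succ_par // inE.
    have pos_p : all (leq 1) (drop_ones (2 :: s)).
      by apply/allP=> x /mapP[[|[|z]]]; rewrite mem_filter => // _ ->.
    apply/mem_elevated; exists (drop_ones (2 :: s)); rewrite sE; split=> //.
      by rewrite -(size_map succn) sE /= szs.
    by rewrite -good_elevate // sE.
  suff -> : [:: 1, 2 & s] \in inserted n by rewrite !orbT.
  (* Two further 1s would form 1211 with the initial 1 2. *)
  have := rep 2 isT; rewrite /=.
  case/splitPr: s1 szs good_w pos_s {rep} => p1 p2 szs good_w pos_s no11.
  have no1p1 : 1 \notin p1.
    apply: contra no11 => p1_1; apply: (cat_subseq (s1 := [:: 1]) (s2 := [:: 1])).
      by rewrite sub1seq.
    by rewrite /= sub0seq.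
  have no1p2 : 1 \notin p2.
    apply: contra no11 => p2_1; apply: (cat_subseq (s1 := [::]) (s2 := [:: 1; 1])).
      exact: sub0seq.
    by rewrite /= sub1seq.
  move: pos_s; rewrite /= all_cat /= => /andP[pos1 pos2].
  have uE : map succn (drop_ones (2 :: p1)) = 2 :: p1 by rewrite succ_par // inE.
  have vE : map succn (drop_ones p2) = p2 by rewrite succ_par.
  have pos_par t : all (leq 1) (drop_ones t).
    by apply/allP=> x /mapP[[|[|z]]]; rewrite mem_filter => // _ ->.
  have pos_uv : all (leq 1) (drop_ones (2 :: p1) ++ drop_ones p2) by rewrite all_cat !pos_par.
  have wE : [:: 1, 2 & p1 ++ 1 :: p2] =
      1 :: map succn (drop_ones (2 :: p1)) ++ 1 :: map succn (drop_ones p2) by rewrite uE vE.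
  rewrite wE good_insert // in good_w; case/andP: good_w => good_uv dec_v.
  apply/mem_inserted; exists (drop_ones (2 :: p1)), (drop_ones p2); split=> //.
  rewrite -(size_map succn) map_cat uE vE -szs !size_cat /=; lia.
rewrite inE !mem_cat => /or4P[/eqP-> | /mem_e[s [-> szs low_s _]] |
  /mem_elevated[v [-> szv gv]] | /mem_inserted[u [v [-> szuv _ dec_v guv]]]]; apply/mem_words.
- by rewrite size_nseq; split=> //; apply: (good_ones n.+2).
- by rewrite good_11.
- by rewrite /= size_map szv good_elevate ?good_pos.
- rewrite good_insert ?good_pos // guv dec_v; split=> //.
  by rewrite /= size_cat /= !size_map addnS -size_cat szuv.
Qed.

Lemma words0 : perm_eq (words 0) [:: [::]].
Proof.
apply: uniq_perm; rewrite ?uniq_words // => w; rewrite inE.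
apply/idP/eqP => [/mem_words[/size0nil] // | ->].
by apply/mem_words; split=> //; apply: (good_ones 0).
Qed.

Lemma words1 : perm_eq (words 1) [:: [:: 1]].
Proof.
apply: uniq_perm; rewrite ?uniq_words // => w; rewrite inE.
apply/idP/eqP => [/mem_words[szw /good_head[w0 | [s ws]]] | ->].
- by rewrite w0 in szw.
- by case: s ws szw => [|x s] ->.
by apply/mem_words; split=> //; apply: (good_ones 1).
Qed.

(** * Suffix lengths of the words in the decomposition *)

Lemma wdsuffix_cons_start11 n w : w \in start11 n -> wdsuffix (1 :: w) = wdsuffix w.
Proof.
case/mem_start11=> s [-> _ _ s2]; rewrite wdsuffix_cons //.
apply/negP; rewrite /= => /(order_path_min _) min1.
have /allP/(_ 2 s2) // : all (geq 1) s.
by apply: min1 => y x z /=; lia.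
Qed.

Lemma sorted_nseq2 n : sorted geq (nseq n 2).
Proof. by elim: n => // -[|n] //= ->. Qed.

Lemma wdsuffix_112 k : wdsuffix [:: 1, 1, 2 & nseq k 2] = k.+1.
Proof. by rewrite (@wdsuffix_cat_asc [:: 1] 1 2) ?size_nseq //; apply: (sorted_nseq2 k.+1). Qed.

(** A final 1 prolongs the run of [k.+1] letters 2; if a 2 follows the 1, only the 2s behind that
    ascent count. *)
Lemma wdsuffix_112_1 k m :
  wdsuffix [:: 1, 1, 2 & nseq k 2 ++ 1 :: nseq m 2] = if m is 0 then k.+2 else m.
Proof.
case: m => [|m].
  rewrite cats1 -!rcons_cons wdsuffix_rcons1 ?wdsuffix_112 //=.
  by rewrite all_nseq orbT.
rewrite (@wdsuffix_cat_asc [:: 1, 1, 2 & nseq k 2] 1 2) ?size_nseq //.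
exact: (sorted_nseq2 m.+1).
Qed.

(** A 1 put at the end prolongs the suffix. Any other inserted 1 is followed by a larger letter, so
    the suffix begins right behind it. *)
Lemma wdsuffix_insert_one w r : all (leq 1) w -> r < size w -> r <= wdsuffix w ->
  wdsuffix (insert_one w r) = if r is 0 then (wdsuffix w).+1 else r.
Proof.
move=> pos_w ltr ler; have w_nil : w != [::] by case: (w) ltr.
case: r ltr ler => [|r] ltr ler.
  rewrite /insert_one subn0 take_size drop_size cats1 -rcons_cons wdsuffix_rcons1; last first.
    by rewrite /= all_map; apply/allP=> x _.
  by case: (w) w_nil pos_w => // x s _ pos_w; rewrite wdsuffix_elevate.
rewrite leq_wdsuffix 1?ltnW // in ler; rewrite /insert_one.
have sz_drop : size (drop (size w - r.+1) w) = r.+1 by rewrite size_drop subKn // ltnW.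
have pos_drop : all (leq 1) (drop (size w - r.+1) w).
  by apply/allP=> x /mem_drop /(allP pos_w).
case: (drop _ w) sz_drop pos_drop ler => // x v [szv] /andP[x_gt0 _] dec.
rewrite -cat_cons (@wdsuffix_cat_asc _ 1 x.+1) ?size_map ?szv //.
by rewrite -(sorted_geq_map_succ (x :: v)) in dec.
Qed.

Lemma wdsuffix_ones n : wdsuffix (nseq n 1) = n.
Proof. by rewrite wdsuffix_sorted ?size_nseq //; case: n => //; elim=> //= n ->. Qed.

Local Open Scope ring_scope.

(** * Truncated power series *)

Section TruncatedSeries.
Variables (R : comNzRingType) (t : R) (N : nat).
Hypothesis tN0 : t ^+ N = 0.

(** In a ring with [t ^+ N = 0] this finite sum serves as the generating function, and series
    identities become ring identities. *)
Definition trunc_gf (a : nat -> R) : R := \sum_(n < N) a n * t ^+ n.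

Lemma eq_trunc_gf a b : a =1 b -> trunc_gf a = trunc_gf b.
Proof. by move=> eq_ab; apply: eq_bigr => i _; rewrite eq_ab. Qed.

Lemma trunc_gf_shift a : trunc_gf a = a 0%N + t * trunc_gf (fun n => a n.+1).
Proof.
(* Adding the vanishing term of index [N] makes the index shift exact. *)
have -> : trunc_gf a = \sum_(n < N.+1) a n * t ^+ n by rewrite big_ord_recr /= tN0 mulr0 addr0.
rewrite big_ord_recl mulr1 mulr_sumr; congr (_ + _).
by apply: eq_bigr => i _; rewrite /= /bump /= add1n exprS mulrCA.
Qed.

Lemma trunc_gfD a b : trunc_gf (fun n => a n + b n) = trunc_gf a + trunc_gf b.
Proof. by rewrite -big_split; apply: eq_bigr => i _; rewrite mulrDl. Qed.

Lemma trunc_gfZ c a : trunc_gf (fun n => c * a n) = c * trunc_gf a.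
Proof. by rewrite mulr_sumr; apply: eq_bigr => i _; rewrite mulrA. Qed.

Variables (C D : R).
Hypotheses (CE : C = 1 + t ^+ 2 * C * D) (DE : D = C + t * D).
Let T e := C ^+ e * D.

(** Induction on [e]: both sides grow by [(C - 1) * T e], because [CE] and [DE] give
    [t^2 C^2 = (1 - t)(C - 1)]. *)
Lemma tree_series_rec e : T e = 1 + t * T e + t ^+ 2 * \sum_(r < e.+1) T r.+1.
Proof.
elim: e => [|e IHe].
  rewrite big_ord_recl big_ord0 /T /= expr0 mul1r expr1 {1}DE {1}CE.
  by rewrite addr0 addrAC mulrA.
rewrite big_ord_recr /=.
have -> : T e.+1 = T e + (C - 1) * T e by rewrite /T exprS; ring.
have -> : T e.+2 = C ^+ 2 * T e by rewrite /T 2!exprS; ring.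
have E : (C - 1) * T e = t * (C - 1) * T e + t ^+ 2 * (C ^+ 2 * T e).
  have D1 : (C - 1) * D = t * (C - 1) * D + (C - 1) * C by rewrite {1}DE; ring.
  have -> : (C - 1) * T e = C ^+ e * ((C - 1) * D) by rewrite /T; ring.
  have -> : t ^+ 2 * (C ^+ 2 * T e) = C ^+ e * ((t ^+ 2 * C * D) * C) by rewrite /T; ring.
  have -> : t ^+ 2 * C * D = C - 1 by rewrite {2}CE; ring.
  by rewrite {1}D1 /T; ring.
by rewrite {1}IHe {1}E; ring.
Qed.

(** The sequence [p] counts avoiders and [w] is their weighted sum; [x], [y] and [k] are the
    weighted sums over [start11], [start112] and the insertions, and [z] collects partial sums of
    [T]. The unknown [W] cancels, and only [G] and [X], which are explicit in [C] and [D],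
    remain. *)
Lemma gf_solution (p w x y z k : nat -> R) :
  p 0%N = 1 -> w 1%N = T 1 ->
  (forall n, w n.+2 = T n.+2 + x n.+2 + w n.+1 + k n) ->
  k 0%N = 0 ->
  (forall n, t ^+ 2 * k n.+1 =
     w n.+1 - p n.+1 - t * w n.+1 - t ^+ 2 * T n.+1) ->
  x 2%N = 0 -> (forall n, x n.+3 = x n.+2 + y n) ->
  y 0%N = T 1 -> (forall n, y n.+1 = 2%:R * T n.+2 + z n) ->
  z 0%N = 0 -> (forall n, z n.+1 = z n + T n.+1) ->
  2%:R * t ^+ 2 * (1 - t) ^+ 2 * (1 - 3%:R * t + t ^+ 2) * trunc_gf p =
    (1 - t ^+ 2) * (1 - t) ^+ 2 * (1 - t - 2%:R * t ^+ 2 * C)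
    - (1 - 3%:R * t - 2%:R * t ^+ 2 + 14%:R * t ^+ 3 - 15%:R * t ^+ 4
       + 3%:R * t ^+ 5).
Proof.
move=> p0 w1 wS k0 kS x2 xS y0 yS z0 zS.
set G := trunc_gf (fun n => T n.+1).
have GE : G = C * D + t * C * G.
  rewrite {1}/G trunc_gf_shift {1}/T expr1; congr (_ + _); rewrite -mulrA; congr (_ * _).
  by rewrite -trunc_gfZ; apply: eq_trunc_gf => n; rewrite /T [C ^+ n.+2]exprS mulrA.
have G2 : trunc_gf (fun n => T n.+2) = C * G.
  by rewrite -trunc_gfZ; apply: eq_trunc_gf => n; rewrite /T [C ^+ n.+2]exprS mulrA.
have ZE : trunc_gf z = t * (trunc_gf z + G).
  by rewrite [LHS]trunc_gf_shift z0 add0r -trunc_gfD; congr (_ * _); apply: eq_trunc_gf.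
have YE : trunc_gf y = C * D + t * (2%:R * (C * G) + trunc_gf z).
  rewrite [LHS]trunc_gf_shift y0 /T expr1 -G2 -(trunc_gfZ 2%:R) -trunc_gfD.
  by congr (_ + _ * _); apply: eq_trunc_gf.
set X := trunc_gf (fun n => x n.+2).
have XE : X = t * (X + trunc_gf y).
  by rewrite {1}/X trunc_gf_shift x2 add0r -trunc_gfD; congr (_ * _); apply: eq_trunc_gf.
set W := trunc_gf (fun n => w n.+1).
have WE : W = C * D + t * (C * G + X + W + trunc_gf k).
  rewrite {1}/W trunc_gf_shift w1 /T expr1 -G2 -!trunc_gfD.
  by congr (_ + _ * _); apply: eq_trunc_gf.
set P := trunc_gf (fun n => p n.+1).
have KE : t * trunc_gf k = W - P - t * W - t ^+ 2 * G.
  rewrite trunc_gf_shift k0 add0r mulrA -expr2 -(trunc_gfZ (t ^+ 2)) (eq_trunc_gf _ _ kS).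
  pose m1 : R := -1.
  rewrite (eq_trunc_gf _ (fun n => w n.+1 + m1 * p n.+1 + (- t) * w n.+1
                                + (- t ^+ 2) * T n.+1)); last first.
    by move=> n; rewrite /m1; ring.
  by rewrite !trunc_gfD !trunc_gfZ -/W -/P -/G /m1; ring.
have PE : P = G + t * X - t ^+ 2 * G.
  have -> : P = W - t * W - t ^+ 2 * G - t * trunc_gf k by rewrite KE; ring.
  by rewrite {1}WE {3}GE; ring.
rewrite [trunc_gf p]trunc_gf_shift p0 -/P.
(* As [t] is nilpotent, its powers cannot be cancelled; [C * D] and [C ^+ 2] are replaced only
   together with a factor [t ^+ 2]. *)
have CD : t ^+ 2 * (C * D) = C - 1 by rewrite {2}CE; ring.
have CC : t ^+ 2 * C ^+ 2 = (1 - t) * (C - 1).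
  have D1 : (1 - t) * D = C by rewrite mulrBl mul1r {1}DE; ring.
  have -> : (1 - t) * (C - 1) = t ^+ 2 * C * ((1 - t) * D) by rewrite -CD; ring.
  by rewrite D1; ring.
set q := 1 - 3%:R * t + t ^+ 2.
(* By [GE], [(1 - t C) G = C D]. Multiplying by [1 - 2t - t^2 C], the conjugate of [1 - t C] up to a
   factor, rationalizes this: the product of the two is [q]. *)
have qG : q * G = (1 - 2%:R * t - t ^+ 2 * C) * (C * D).
  have -> : C * D = G - t * C * G by rewrite {1}GE; ring.
  have -> : (1 - 2%:R * t - t ^+ 2 * C) * (G - t * C * G) =
     (1 - 2%:R * t - t ^+ 2 * C - t * C + 2%:R * t ^+ 2 * C
      + t * (t ^+ 2 * C ^+ 2)) * G by ring.
  by rewrite CC /q; ring.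
have tqG : t ^+ 2 * (q * G) = t - t * (1 - t) * C.
  rewrite qG.
  have -> : t ^+ 2 * ((1 - 2%:R * t - t ^+ 2 * C) * (C * D)) =
    (1 - 2%:R * t - t ^+ 2 * C) * (t ^+ 2 * (C * D)) by ring.
  rewrite CD.
  have -> : (1 - 2%:R * t - t ^+ 2 * C) * (C - 1) =
     (1 - 2%:R * t) * (C - 1) - t ^+ 2 * C ^+ 2 + t ^+ 2 * C by ring.
  by rewrite CC; ring.
have X2 : (1 - t) ^+ 2 * X =
    (2%:R * t * (1 - t) + t ^+ 3) * G - t * (1 - t) * (C * D).
  have X1 : (1 - t) * X = t * trunc_gf y by rewrite mulrBl mul1r {1}XE; ring.
  have Z1 : (1 - t) * trunc_gf z = t * G by rewrite mulrBl mul1r {1}ZE; ring.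
  have tCG : t * C * G = G - C * D by rewrite {2}GE; ring.
  rewrite expr2 -mulrA X1 YE.
  have -> : (1 - t) * (t * (C * D + t * (2%:R * (C * G) + trunc_gf z))) =
    t * (1 - t) * (C * D) + 2%:R * t * (1 - t) * (t * C * G)
    + t ^+ 2 * ((1 - t) * trunc_gf z) by ring.
  by rewrite Z1 tCG; ring.
(* Grouped so that [tqG] and [X2] apply. *)
have -> : 2%:R * t ^+ 2 * (1 - t) ^+ 2 * q * (1 + t * P) =
  2%:R * t ^+ 2 * (1 - t) ^+ 2 * q
  + 2%:R * t * (1 - t) ^+ 2 * (1 - t ^+ 2) * (t ^+ 2 * (q * G))
  + 2%:R * t ^+ 4 * q * ((1 - t) ^+ 2 * X) by rewrite PE; ring.
rewrite X2.
have -> : 2%:R * t ^+ 4 * q *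
   ((2%:R * t * (1 - t) + t ^+ 3) * G - t * (1 - t) * (C * D)) =
  2%:R * t ^+ 2 * (2%:R * t * (1 - t) + t ^+ 3) * (t ^+ 2 * (q * G))
  - 2%:R * t ^+ 3 * (1 - t) * q * (t ^+ 2 * (C * D)) by ring.
by rewrite CD tqG /q; ring.
Qed.

End TruncatedSeries.

(** * Coefficients of power series through polynomials modulo a power of the variable *)

Lemma eq_in_qpolyXn (A : comNzRingType) (N n : nat) (p q : {poly A}) :
  (n < N.+1)%N -> in_qpoly 'X^(N.+1) p = in_qpoly 'X^(N.+1) q -> p`_n = q`_n.
Proof.
move=> ltn /(congr1 val) /=; rewrite mk_monic_Xn /=.
move=> E.
have coefmod (r : {poly A}) : (Pdiv.CommonRing.rmodp r 'X^(N.+1))`_n = r`_n.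
  rewrite [in RHS](Pdiv.RingMonic.rdivp_eq (monicXn A N.+1) r).
  by rewrite coefD coefMXn ltn add0r.
by rewrite -coefmod E coefmod.
Qed.

Lemma poly_of_congr (p q : {poly rat}) N :
  (forall k, (k < N)%N -> p`_k = q`_k) -> exists r, p = q + r * 'X^N.
Proof.
move=> E; exists (drop_poly N p - drop_poly N q).
have qE : q - drop_poly N q * 'X^N = take_poly N q.
  by rewrite -{1}[q](poly_take_drop N) addrK.
have take_eq : take_poly N q = take_poly N p.
  by apply/polyP=> i; rewrite !coef_take_poly; case: ifP => // /E.
by rewrite mulrBl addrCA qE take_eq addrC poly_take_drop.
Qed.

Lemma ser_mul_poly (A : {poly rat}) (f : nat -> rat) n M : (n < M)%N ->
  ser_mul (poly_ser A) f n = (A * \poly_(i < M) f i)`_n.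
Proof.
move=> ltn; rewrite coefM; apply: eq_bigr => i _.
by rewrite coef_poly (leq_ltn_trans (leq_subr _ _) ltn).
Qed.

(** * The square root and the transfer to formal power series *)

Section Sqrt.
Variable S : nat -> rat.
Hypothesis S0 : S 0%N = 1.
Hypothesis SS : forall n, ser_mul S S n =
               poly_ser ((1 - 'X) * (1 - 'X - 4%:R *: 'X^2)) n.

(** The first two coefficients of [S] are 1 and -1, which defines [C]; squaring turns the equation
    of [S] into a quadratic one for [C]. Dividing by [4 X^2] costs two orders, hence [N.+2]. *)
Lemma sqrt_catalan N : exists C r : {poly rat},
  \poly_(i < N.+2) S i = 1 - 'X - 2%:R * 'X^2 * C /\
  'X^2 * C ^+ 2 = (1 - 'X) * (C - 1) + r * 'X^N.
Proof.
have S1 : S 1%N = -1.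
  have := SS 1; rewrite /ser_mul big_ord_recl big_ord1 /= S0 mul1r mulr1.
  rewrite /poly_ser coefM !big_ord_recl big_ord0 /= !coefB !coefZ !coefXn !coefX !coef1 /=.
  rewrite /bump /=; lra.
set P := \poly_(i < N.+2) S i.
have [h hE] : exists h : {poly rat}, 2%:R * h = 1.
  by exists (2%:R^-1)%:P; rewrite -polyC_natr -polyCM mulfV.
pose C := - h * drop_poly 2 P.
have PE : P = 1 - 'X - 2%:R * 'X^2 * C.
  rewrite -[LHS](poly_take_drop 2).
  have -> : take_poly 2 P = 1 - 'X.
    apply/polyP=> -[|[|i]]; rewrite coef_take_poly coef_poly coefB coef1 coefX /=
      ?S0 ?S1 ?subr0 ?sub0r ?oppr0 //.
  have -> : 2%:R * 'X^2 * C = - ((2%:R * h) * drop_poly 2 P * 'X^2) by rewrite /C; ring.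
  by rewrite hE mul1r opprK.
have [r rE] : exists r, P * P = (1 - 'X) * (1 - 'X - 4%:R *: 'X^2) + r * 'X^(N.+2).
  apply: poly_of_congr => k ltk; rewrite -[RHS]SS coefM; apply: eq_bigr => i _.
  by rewrite !coef_poly (leq_ltn_trans (leq_subr _ _) ltk) (leq_ltn_trans _ ltk) // -ltnS.
exists C, (h ^+ 2 * r); split=> //.
(* Polynomials over the rationals form a domain, so [4 X^2] may be cancelled here. *)
apply: (@mulfI _ (4%:R * 'X^2)).
  by apply: mulf_neq0; rewrite -?polyC_natr ?polyC_eq0 // -size_poly_eq0 size_polyXn.
have -> : 4%:R * 'X^2 * ('X^2 * C ^+ 2) = P * P - (1 - 'X) ^+ 2 + 4%:R * 'X^2 * (1 - 'X) * C.
  by rewrite PE; ring.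
have -> : 4%:R * 'X^2 * ((1 - 'X) * (C - 1) + h ^+ 2 * r * 'X^N) =
   4%:R * 'X^2 * (1 - 'X) * (C - 1) + (2%:R * h) ^+ 2 * r * 'X^(N.+2).
  by rewrite [X in _ = _ + _ * X](exprD _ 2 N); ring.
have X4 : 4%:R *: 'X^2 = 4%:R * 'X^2 :> {poly rat} by rewrite scaler_nat mulr_natl.
by rewrite rE hE X4; ring.
Qed.

(** The hypothesis is used in the polynomials modulo [X^(n+1)], with [t] the class of [X] and [C]
    taken from [sqrt_catalan]; there it determines the coefficient of index [n]. *)
Lemma gf_transfer (c : nat -> nat) :
  (forall (R : comNzRingType) (t : R) (N : nat), t ^+ N = 0 ->
     forall C D : R, C = 1 + t ^+ 2 * C * D -> D = C + t * D ->
     2%:R * t ^+ 2 * (1 - t) ^+ 2 * (1 - 3%:R * t + t ^+ 2)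
       * trunc_gf R t N (fun n => (c n)%:R) =
     (1 - t ^+ 2) * (1 - t) ^+ 2 * (1 - t - 2%:R * t ^+ 2 * C)
     - (1 - 3%:R * t - 2%:R * t ^+ 2 + 14%:R * t ^+ 3 - 15%:R * t ^+ 4
        + 3%:R * t ^+ 5)) ->
  forall n,
    ser_mul (poly_ser (2%:R *: 'X^2 * (1 - 'X) ^+ 2 * (1 - 3%:R *: 'X + 'X^2)))
            (fun k => (c k)%:R) n
    = ser_sub
        (ser_mul (poly_ser ((1 - 'X^2) * (1 - 'X) ^+ 2)) S)
        (poly_ser (1 - 3%:R *: 'X - 2%:R *: 'X^2 + 14%:R *: 'X^3
                   - 15%:R *: 'X^4 + 3%:R *: 'X^5)) n.
Proof.
move=> gfE n.
have [C [r [SE CE]]] := sqrt_catalan n.+1.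
(* [S] is cut at [n.+3] to match [sqrt_catalan] at [n.+1]. *)
rewrite /ser_sub (@ser_mul_poly _ _ _ n.+1) // (@ser_mul_poly _ _ _ n.+3);
  last by rewrite !ltnS leqW.
rewrite /poly_ser -coefB; apply: (@eq_in_qpolyXn _ n) => //.
have natZ k (p : {poly rat}) : k%:R *: p = k%:R * p by rewrite scaler_nat mulr_natl.
rewrite SE !natZ.
set h := 'X^(n.+1).
pose q : {rmorphism {poly rat} -> {poly %/ h}} := in_qpoly h.
rewrite -[LHS]/(q _) -[RHS]/(q _).
have rmE := (rmorph_nat q, rmorph1 q, rmorphXn q, rmorphB q, rmorphM q, rmorphD q).
pose t := q 'X.
have tN : t ^+ n.+1 = 0.
  rewrite -rmorphXn; apply/val_inj => /=.
  by rewrite mk_monic_Xn -/h Pdiv.RingMonic.rmodpp // monicXn.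
(* The inverse of [1 - t], needed for [D = C / (1 - t)]. *)
pose I := \sum_(i < n.+1) t ^+ i.
have IE : (1 - t) * I = 1.
  have := subrX1 t n.+1; rewrite tN sub0r -/I => E.
  by rewrite -opprB mulNr -E opprK.
have qC : t ^+ 2 * q C ^+ 2 = (1 - t) * (q C - 1).
  have /(congr1 q) := CE.
  by rewrite !rmE -/t tN mulr0 addr0.
have D1 : (1 - t) * (q C * I) = q C by rewrite mulrCA IE mulr1.
have {gfE} := gfE _ t n.+1 tN (q C) (q C * I) _ _.
have -> : trunc_gf _ t n.+1 (fun k => (c k)%:R) = q (\poly_(i < n.+1) (c i)%:R).
  rewrite poly_def rmorph_sum; apply: eq_bigr => i _.
  by rewrite -mul_polyC rmorphM rmorphXn /= polyC_natr rmorph_nat.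
rewrite /t; move=> E.
rewrite !rmE.
apply: E.
  have -> : t ^+ 2 * q C * (q C * I) = t ^+ 2 * q C ^+ 2 * I by ring.
  rewrite qC mulrAC IE mul1r; ring.
by rewrite -{2}D1; ring.
Qed.
End Sqrt.

(** * The generating function *)

Section Sums.
Variables (R : comNzRingType) (T : nat -> R).

Definition wdsuffix_sum (s : seq (seq nat)) : R := \sum_(w <- s) T (wdsuffix w).

Lemma wdsuffix_sum_cat s s' : wdsuffix_sum (s ++ s') = wdsuffix_sum s + wdsuffix_sum s'.
Proof. exact: big_cat. Qed.

Lemma wdsuffix_sum_cons w s : wdsuffix_sum (w :: s) = T (wdsuffix w) + wdsuffix_sum s.
Proof. exact: big_cons. Qed.

Lemma sum_iota (F : nat -> R) n : \sum_(r <- iota 0 n) F r = \sum_(r < n) F r.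
Proof. by rewrite -(big_mkord xpredT) /index_iota subn0. Qed.

Lemma wdsuffix_sum_start11S n :
  wdsuffix_sum (start11 n.+3) = wdsuffix_sum (start11 n.+2) + wdsuffix_sum (start112 n).
Proof.
rewrite -[start11 n.+3]/(map (cons 1%N) (start11 n.+2) ++ start112 n) wdsuffix_sum_cat.
rewrite {1}/wdsuffix_sum big_map.
by congr (_ + _); apply: eq_big_seq => w /wdsuffix_cons_start11 ->.
Qed.

Lemma wdsuffix_sum_start112_0 : wdsuffix_sum (start112 0) = T 1.
Proof. by rewrite /wdsuffix_sum big_seq1. Qed.

(** The factor 2 comes from the word without a third 1 and the word ending in 1, both of suffix
    length [n.+2]. *)
Lemma wdsuffix_sum_start112S n :
  wdsuffix_sum (start112 n.+1) = 2%:R * T n.+2 + \sum_(m < n) T m.+1.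
Proof.
rewrite /wdsuffix_sum big_cons wdsuffix_112 big_map sum_iota.
under eq_bigr do rewrite wdsuffix_112_1.
by rewrite big_ord_recl subn0 addrA -mulr2n mulr_natl.
Qed.

(** The weighted sum over [inserted n], with suffix lengths as in [wdsuffix_insert_one]. *)
Definition label_sum (n : nat) : R :=
  \sum_(w <- words n) \sum_(r < minn (wdsuffix w).+1 n)
    T (if r : nat is 0 then (wdsuffix w).+1 else r).

Lemma wdsuffix_sum_words n : wdsuffix_sum (words n.+2) =
  T n.+2 + wdsuffix_sum (start11 n.+2) + wdsuffix_sum (words n.+1) + label_sum n.
Proof.
rewrite {1}/wdsuffix_sum (perm_big _ (words_decomposition n)).
rewrite -/(wdsuffix_sum _) wdsuffix_sum_cons.
rewrite (wdsuffix_sum_cat (start11 _)) (wdsuffix_sum_cat (elevated _)) !addrA.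
rewrite wdsuffix_ones.
congr (_ + _ + _ + _).
  rewrite /wdsuffix_sum big_map; apply: eq_big_seq => w /mem_words[szw gw].
  by case: w szw gw => // x s _ gw; rewrite wdsuffix_elevate ?good_pos.
rewrite /wdsuffix_sum big_allpairs_dep /label_sum; apply: eq_big_seq => w /mem_words[szw gw].
rewrite -(sum_iota (fun r => T (if r is 0 then (wdsuffix w).+1 else r))).
apply: eq_big_seq => r; rewrite mem_iota add0n leq_min => /and3P[_ ler ltr].
by rewrite wdsuffix_insert_one ?good_pos ?szw.
Qed.

Lemma label_sum0 : label_sum 0 = 0.
Proof. by rewrite /label_sum big1 // => w _; rewrite minn0 big_ord0. Qed.

(** A nonconstant word with suffix length [e] yields each of the lengths 1 to [e + 1] once. For the
    constant word the length [e = n.+1] is missing, which is the subtracted term. *)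
Lemma label_sumS n : label_sum n.+1 =
  \sum_(w <- words n.+1) \sum_(r < (wdsuffix w).+1) T r.+1 - T n.+1.
Proof.
have good1 : nseq n.+1 1%N \in words n.+1.
  by apply/mem_words; rewrite size_nseq good_ones.
have sum_label e m : \sum_(r < m.+1) T (if r : nat is 0 then e.+1 else r) =
    T e.+1 + \sum_(r < m) T r.+1 by rewrite big_ord_recl.
rewrite /label_sum !(bigD1_seq _ good1 (uniq_words _)) wdsuffix_ones.
rewrite (minn_idPr (leqnSn _)) sum_label [in RHS]big_ord_recr [in RHS]big_ord_recr /=.
rewrite [RHS]addrAC; congr (_ + _); first by ring.
rewrite big_seq_cond [RHS]big_seq_cond; apply: eq_bigr => w /andP[/mem_words[szw gw] neq1].
have lt_wds : (wdsuffix w < n.+1)%N.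
  rewrite -szw ltn_neqAle wdsuffix_size andbT wdsuffix_eq_size.
  by apply: contra neq1 => /(good_sorted _ gw) {1}->; rewrite szw.
by rewrite (minn_idPl lt_wds) sum_label [RHS]big_ord_recr addrC.
Qed.
End Sums.

Lemma gf_words (R : comNzRingType) (t : R) (N : nat) : t ^+ N = 0 ->
     forall C D : R, C = 1 + t ^+ 2 * C * D -> D = C + t * D ->
     2%:R * t ^+ 2 * (1 - t) ^+ 2 * (1 - 3%:R * t + t ^+ 2)
       * trunc_gf R t N (fun n => (p_count pats n)%:R) =
     (1 - t ^+ 2) * (1 - t) ^+ 2 * (1 - t - 2%:R * t ^+ 2 * C)
     - (1 - 3%:R * t - 2%:R * t ^+ 2 + 14%:R * t ^+ 3 - 15%:R * t ^+ 4
        + 3%:R * t ^+ 5).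
Proof.
move=> tN0 C D CE DE; pose T e := C ^+ e * D.
apply: (gf_solution _ _ _ tN0 _ _ CE DE _ (fun n => wdsuffix_sum _ T (words n))
  (fun n => wdsuffix_sum _ T (start11 n)) (fun n => wdsuffix_sum _ T (start112 n))
  (fun n => \sum_(m < n) T m.+1) (label_sum _ T)).
- by rewrite -size_words (perm_size words0).
- by rewrite /wdsuffix_sum (perm_big _ words1) big_seq1.
- exact: wdsuffix_sum_words.
- exact: label_sum0.
- move=> n; rewrite label_sumS mulrBr; congr (_ - _).
  rewrite -size_words -sum1_size natr_sum /wdsuffix_sum !mulr_sumr -!sumrB.
  apply: eq_bigr => w _.
  (* Summed over all words, the constant 1 of this recurrence produces the number of avoiders. *)
  have E : T (wdsuffix w) = 1 + t * T (wdsuffix w)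
      + t ^+ 2 * \sum_(r < (wdsuffix w).+1) T r.+1.
    exact: tree_series_rec CE DE _.
  by rewrite {1}E; ring.
- by rewrite /wdsuffix_sum big_nil.
- exact: wdsuffix_sum_start11S.
- exact: wdsuffix_sum_start112_0.
- exact: wdsuffix_sum_start112S.
- by rewrite big_ord0.
- by move=> n; rewrite big_ord_recr.
Qed.

(* Generating function of p_n(1123,1211), with denominators cleared:
   for the power series S = sqrt((1-t)(1-t-4t^2)) with constant term 1,
   2t^2(1-t)^2(1-3t+t^2) * F(t)
     = (1-t^2)(1-t)^2 * S(t) - (1-3t-2t^2+14t^3-15t^4+3t^5). *)
Theorem theorem4p22 :
  forall S : nat -> rat,
    S 0%N = 1 ->
    (forall n, ser_mul S S n =
               poly_ser ((1 - 'X) * (1 - 'X - 4%:R *: 'X^2)) n) ->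
    forall n,
      ser_mul (poly_ser (2%:R *: 'X^2 * (1 - 'X) ^+ 2 * (1 - 3%:R *: 'X + 'X^2)))
              (fun k => (p_count [:: [:: 1; 1; 2; 3]%N; [:: 1; 2; 1; 1]%N] k)%:R) n
      = ser_sub
          (ser_mul (poly_ser ((1 - 'X^2) * (1 - 'X) ^+ 2)) S)
          (poly_ser (1 - 3%:R *: 'X - 2%:R *: 'X^2 + 14%:R *: 'X^3
                     - 15%:R *: 'X^4 + 3%:R *: 'X^5)) n.
Proof.
move=> S S0 SS; apply: (gf_transfer _ S0 SS (p_count pats)).
exact: gf_words.
Qed.
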